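(* Let $g_2$ be a constant parameter and consider the system of differential equations $$\dot x_1=-\tfrac{\mathrm{i}}{2}(x_1^2r+\gamma_3),\qquad \dot x_2=\tfrac{\mathrm{i}}{2}(x_2^2r+\gamma_3),\qquad \dot e_1=-\mathrm{i}(x_1+x_2)re_1,\qquad \dot e_2=\mathrm{i}(x_1+x_2)re_2,$$ $$\dot r=\frac{\mathrm{i}}{2}\,\frac{x_1^2-x_2^2+2e_2x_1-2e_1x_2}{(x_1+x_2)^2},\qquad \dot\gamma_3=-\frac{\mathrm{i}}{8}\,\frac{g_2(x_1^2-x_2^2)+8e_2x_1^3-8e_1x_2^3}{(x_1+x_2)^2},$$ subject to the invariant relations (with constants $g_3,k$) $$r^2=\frac{2}{x_1+x_2}+\frac{e_1+e_2}{(x_1+x_2)^2},\qquad r\gamma_3=\frac{4x_1x_2-g_2}{4(x_1+x_2)}-\frac{x_2^2e_1+x_1^2e_2}{(x_1+x_2)^2},$$ $$\gamma_3^2=-\frac{x_1x_2g_2}{2(x_1+x_2)}+\frac{x_2^4e_1+x_1^4e_2}{(x_1+x_2)^2}+\frac{g_3}{2},\qquad e_1e_2=k^2.$$ This system is integrated through the solutions of the system $$\frac{ds_1}{\sqrt{\Phi(s_1)}}+\frac{ds_2}{\sqrt{\Phi(s_2)}}=0,\qquad \frac{s_1\,ds_1}{\sqrt{\Phi(s_1)}}+\frac{s_2\,ds_2}{\sqrt{\Phi(s_2)}}=\mathrm{i}\,dt,$$ where $$\Phi(s)=P(s)(s-k)(s+k),\qquad P(s)=2s^3-\frac{g_2}{2}s-\frac{g_3}{2};$$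 that is, the functions $s_1,s_2$ of $(x_1,x_2)$ defined as the two roots of $\mathcal{F}(x_1,x_2,s)=0$ (with $\mathcal F$ as given in the context) satisfy these equations along solutions, for suitable choices of the branches of the square roots. The system is linearized on the Jacobian of the curve $\Gamma:\ y^2=\Phi(s)$.
   Context: The dot denotes $d/dt$ and $\mathrm{i}$ is the imaginary unit. The polynomial $\mathcal F$ is $$\mathcal{F}(x_1,x_2,s)=A(x_1,x_2)s^2+B(x_1,x_2)s+C(x_1,x_2),$$ with $$A=(x_1-x_2)^2,\qquad B=-2x_1x_2(x_1+x_2)+\frac{g_2}{2}(x_1+x_2)+g_3,\qquad C=x_1^2x_2^2+\frac{g_2}{2}x_1x_2+g_3(x_1+x_2)+\frac{g_2^2}{16}.$$ The variables $s_1,s_2$ are the two solutions of $\mathcal{F}(x_1,x_2,s)=0$ as a quadratic equation in $s$: $$s_1=\frac{-B-\sqrt{B^2-4AC}}{2A},\qquad s_2=\frac{-B+\sqrt{B^2-4AC}}{2A}.$$ ''Linearized on the Jacobian'' means that the motion becomes linear in $t$ under the Abel map with holomorphic differentials $ds/y$, $s\,ds/y$ of the genus two curve $\Gamma$ (for generic constants).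
   Formalization: In the third invariant relation (for γ_3²) the constant term is taken as −g_3/2 instead of the printed +g_3/2; with the printed sign the separated equations fail when g_3 ≠ 0 for generic data. *)

(* Defs.v *)
From Stdlib Require Export Reals.
From Coquelicot Require Export Coquelicot.

Open Scope C_scope.

Definition is_derivC (f : R -> C) (t : R) (l : C) : Prop :=
  @is_derive R_AbsRing C_R_NormedModule f t l.

Definition contC (f : R -> C) (t : R) : Prop :=
  @continuous R_UniformSpace C_UniformSpace f t.

Definition is_intC (f : R -> C) (a b : R) (l : C) : Prop :=
  @is_RInt C_R_NormedModule f a b l.

Definition time_interval (a b : Rbar) (t : R) : Prop := Rbar_lt a t /\ Rbar_lt t b.

Section Polynomials.

Variables g2 g3 k : C.

Definition coefA (x1 x2 : C) : C := (x1 - x2) ^ 2.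

Definition coefB (x1 x2 : C) : C :=
  - (2 * x1 * x2 * (x1 + x2)) + g2 / 2 * (x1 + x2) + g3.

Definition coefC (x1 x2 : C) : C :=
  x1 ^ 2 * x2 ^ 2 + g2 / 2 * x1 * x2 + g3 * (x1 + x2) + g2 ^ 2 / 16.

Definition discF (x1 x2 : C) : C :=
  coefB x1 x2 ^ 2 - 4 * coefA x1 x2 * coefC x1 x2.

Definition polF (x1 x2 s : C) : C :=
  coefA x1 x2 * s ^ 2 + coefB x1 x2 * s + coefC x1 x2.

Definition rootF (x1 x2 w : C) : C := (- coefB x1 x2 + w) / (2 * coefA x1 x2).

Lemma rootF_spec (x1 x2 w : C) :
  coefA x1 x2 <> 0 -> w ^ 2 = discF x1 x2 ->
  forall s : C,
    polF x1 x2 s =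
    coefA x1 x2 * (s - rootF x1 x2 (- w)) * (s - rootF x1 x2 w).
Proof.
intros hA hw s.
assert (h : coefC x1 x2 = (coefB x1 x2 ^ 2 - w ^ 2) / (4 * coefA x1 x2)).
{ rewrite hw; unfold discF; field; exact hA. }
unfold polF, rootF; rewrite h; field; exact hA.
Qed.

Definition polP (s : C) : C := 2 * s ^ 3 - g2 / 2 * s - g3 / 2.

Definition Phi (s : C) : C := polP s * (s - k) * (s + k).

Definition dPhi (s : C) : C :=
  (6 * s ^ 2 - g2 / 2) * (s - k) * (s + k) + polP s * (2 * s).

(* [Phi] has degree five, so y^2 = Phi(s) has genus two exactly when the roots
   of [Phi] are simple. *)
Definition genus_two : Prop := forall s : C, Phi s = 0 -> dPhi s <> 0.

End Polynomials.

Definition equations_of_motion (g2 : C) (I : R -> Prop)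
    (x1 x2 e1 e2 r gam3 : R -> C) : Prop :=
  forall t : R, I t ->
    is_derivC x1 t (- (Ci / 2) * (x1 t ^ 2 * r t + gam3 t)) /\
    is_derivC x2 t (Ci / 2 * (x2 t ^ 2 * r t + gam3 t)) /\
    is_derivC e1 t (- Ci * (x1 t + x2 t) * r t * e1 t) /\
    is_derivC e2 t (Ci * (x1 t + x2 t) * r t * e2 t) /\
    is_derivC r t
      (Ci / 2 * ((x1 t ^ 2 - x2 t ^ 2 + 2 * e2 t * x1 t - 2 * e1 t * x2 t)
                 / (x1 t + x2 t) ^ 2)) /\
    is_derivC gam3 t
      (- (Ci / 8) * ((g2 * (x1 t ^ 2 - x2 t ^ 2)
                      + 8 * e2 t * x1 t ^ 3 - 8 * e1 t * x2 t ^ 3)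
                     / (x1 t + x2 t) ^ 2)).

(* The constant term of the third relation is - g3/2.  With this sign the
   relations give 4 x1' x2' = - B/2 and 4 x1'^2 = - (P(x1) + e1 (x1 - x2)^2),
   with B and P the polynomials [coefB] and [polP] of the same parameters
   (g2, g3); with + g3/2 they would give the polynomials of (g2, - g3). *)
Definition invariant_relations (g2 g3 k x1 x2 e1 e2 r gam3 : C) : Prop :=
  r ^ 2 = 2 / (x1 + x2) + (e1 + e2) / (x1 + x2) ^ 2 /\
  r * gam3 = (4 * x1 * x2 - g2) / (4 * (x1 + x2))
           - (x2 ^ 2 * e1 + x1 ^ 2 * e2) / (x1 + x2) ^ 2 /\
  gam3 ^ 2 = - (x1 * x2 * g2 / (2 * (x1 + x2)))
           + (x2 ^ 4 * e1 + x1 ^ 4 * e2) / (x1 + x2) ^ 2 - g3 / 2 /\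
  e1 * e2 = k ^ 2.

(* [f] coincides on [I] with a continuous choice of a square root of [h]. *)
Definition sqrt_branch (I : R -> Prop) (h f : R -> C) : Prop :=
  forall t : R, I t -> contC f t /\ f t ^ 2 = h t.

Definition separated_equations (f : C -> C) (I : R -> Prop)
    (s1 s2 y1 y2 : R -> C) : Prop :=
  forall t : R, I t ->
    exists l1 l2 : C,
      is_derivC s1 t l1 /\ is_derivC s2 t l2 /\
      (f (s1 t) <> 0 -> f (s2 t) <> 0 ->
       l1 / y1 t + l2 / y2 t = 0 /\
       s1 t * l1 / y1 t + s2 t * l2 / y2 t = Ci).

Section Jacobian.

(* The affine curve y^2 = f(s), where [df] is the derivative of the squarefree
   polynomial [f]. *)
Variables f df : C -> C.

(* [u] is the pair of integrals of ds/y and s ds/y along a C^1 arc of the curve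
   from [p] to [q].  Here [v] is the value of ds/y on the velocity of the arc:
   since 2 y dy = f'(s) ds, it is characterized by s' = y v, y' = f'(s) v / 2,
   also at the points where y = 0.  The arc is run backwards if b < a. *)
Definition arc_integral (p q u : C * C) : Prop :=
  exists (a b : R) (s y v : R -> C),
    (forall t : R, (Rmin a b <= t <= Rmax a b)%R ->
       y t ^ 2 = f (s t) /\
       is_derivC s t (y t * v t) /\
       is_derivC y t (df (s t) * v t / 2) /\
       contC v t) /\
    p = (s a, y a) /\ q = (s b, y b) /\
    is_intC v a b (fst u) /\
    is_intC (fun t => s t * v t) a b (snd u).

Definition add2 (u v : C * C) : C * C := (fst u + fst v, snd u + snd v).

Definition sub2 (u v : C * C) : C * C := (fst u - fst v, snd u - snd v).

Inductive path_integral : C * C -> C * C -> C * C -> Prop :=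
| path_arc : forall p q u, arc_integral p q u -> path_integral p q u
| path_cat : forall p q r u v,
    path_integral p q u -> path_integral q r v -> path_integral p r (add2 u v).

(* Integrals over sums of loops.  Loops need not avoid anything but the point at
   infinity, where both differentials are holomorphic, so these are all the
   periods of the compact curve. *)
Inductive period : C * C -> Prop :=
| period_loop : forall p u, path_integral p p u -> period u
| period_add : forall u v, period u -> period v -> period (add2 u v).

(* Equality in the Jacobian, the quotient of C^2 by the period lattice. *)
Definition jacobian_eq (u v : C * C) : Prop := period (sub2 u v).

(* [u] is a representative in C^2 of the Abel map at the divisor q1 + q2, with
   reference divisor p1 + p2. *)
Definition abel_map (p1 p2 q1 q2 u : C * C) : Prop :=
  exists u1 u2 : C * C,
    path_integral p1 q1 u1 /\ path_integral p2 q2 u2 /\ u = add2 u1 u2.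

Definition linear_on_jacobian (I : R -> Prop) (q1 q2 : R -> C * C) (c : C * C)
    : Prop :=
  forall (p1 p2 : C * C) (t0 t : R) (u0 : C * C), I t0 -> I t ->
    abel_map p1 p2 (q1 t0) (q2 t0) u0 ->
    (exists u : C * C, abel_map p1 p2 (q1 t) (q2 t) u) /\
    (forall u : C * C, abel_map p1 p2 (q1 t) (q2 t) u ->
       jacobian_eq u
         (add2 u0 (RtoC (t - t0) * fst c, RtoC (t - t0) * snd c))).

End Jacobian.

(* Main.v *)
(* Put u1 = x1^2 r + gamma3 and u2 = x2^2 r + gamma3.  The invariant relations
   amount to u1^2 = P(x1) + e1 A, u2^2 = P(x2) + e2 A, 2 u1 u2 = - B and
   e1 e2 = k^2; since B^2 - 4 A C = 4 P(x1) P(x2), these give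
   A k^2 = C - e1 P(x2) - e2 P(x1).  For a root s of F(x1, x2, s), with
   w = F_s = 2 A s + B, implicit differentiation yields s' = y v, where v = i A / w
   and y is an explicit function of x1, x2, u1, u2, s which is regular also at the
   branch points; the relations imply y^2 = Phi(s) and y' = Phi'(s) v / 2.  The two
   roots have opposite w, hence v1 + v2 = 0 and
   s1 v1 + s2 v2 = (s2 - s1) i A / w = i, which are the separated equations.  They
   also say that the flow moves the Abel image with the constant velocity (0, i):
   the difference of two determinations of the Abel map closes up, together with
   the flow arcs, to a pair of loops. *)
Require Import Defs.
From Stdlib Require Import Lra.

Open Scope C_scope.

(** * Calculus of complex-valued functions of a real variable *)

Lemma Cmult_cancel_l (x a b : C) : x <> 0 -> x * a = x * b -> a = b.
Proof.
intros hx h.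
transitivity (/ x * (x * a)); [field; exact hx|].
rewrite h; field; exact hx.
Qed.

Lemma RtoC_neq_0 (x : R) : x <> 0%R -> RtoC x <> 0.
Proof. intros hx h; apply hx; injection h; auto. Qed.

Lemma contC_pair (f : R -> C) (t : R) :
  contC f t <-> continuous (fun z => fst (f z)) t /\ continuous (fun z => snd (f z)) t.
Proof.
split.
- intros h; split.
  + apply (continuous_comp f fst); [exact h|].
    destruct (f t); apply continuous_fst.
  + apply (continuous_comp f snd); [exact h|].
    destruct (f t); apply continuous_snd.
- intros [h1 h2]; unfold contC, continuous.
  rewrite (surjective_pairing (f t)).
  apply (filterlim_ext (fun z => (fst (f z), snd (f z)))).
  { intros z; symmetry; apply surjective_pairing. }
  refine (filterlim_filter_le_2 _ _ (filterlim_pair _ _ h1 h2)).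
  intros P [e he].
  (* A ball of [C] is the product of the balls of its components, so these two sets witness
     membership in the product filter. *)
  exists (fun y => ball (fst (f t)) e y) (fun y => ball (snd (f t)) e y).
  + exists e; auto.
  + exists e; auto.
  + intros x y hx hy; apply he; split; assumption.
Qed.

Lemma derivC_pair (f : R -> C) (t : R) (l : C) :
  is_derivC f t l <->
  is_derive (fun z => fst (f z)) t (fst l) /\ is_derive (fun z => snd (f z)) t (snd l).
Proof.
split.
- intros h; split.
  + refine (filterdiff_ext_lin _ _ _ (filterdiff_comp f fst _ fst h _) _).
    * apply filterdiff_linear, is_linear_fst.
    * reflexivity.
  + refine (filterdiff_ext_lin _ _ _ (filterdiff_comp f snd _ snd h _) _).
    * apply filterdiff_linear, is_linear_snd.
    * reflexivity.
- intros [h1 h2].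
  apply (is_derive_ext (fun z => (fst (f z), snd (f z)))).
  { intros z; symmetry; apply surjective_pairing. }
  refine (filterdiff_ext_lin _ _ _
    (filterdiff_comp_2 _ _ (fun a b => (a, b)) _ _ (fun a b => (a, b)) h1 h2 _) _).
  + apply (filterdiff_ext_lin _ (fun p => p)).
    * apply (filterdiff_ext (fun p => p)); [intros []; reflexivity|].
      apply filterdiff_id.
    * intros []; reflexivity.
  + intros y; reflexivity.
Qed.

(* Since g need only be continuous, this differentiates 1/f and square roots
   through their increments, such as w - w(t) = (h - h(t)) / (w + w(t)). *)
Lemma is_derive_zero_mult (h g : R -> R) (t l : R) :
  h t = 0%R -> is_derive h t l -> continuous g t ->
  is_derive (fun z => (h z * g z)%R) t (l * g t)%R.
Proof.
intros h0 hl hg.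
apply is_derive_Reals in hl; apply is_derive_Reals.
assert (L1 : is_lim (fun e => (h (t + e) - h t) / e)%R 0%R l).
{ apply is_lim_spec; intros eps. destruct (hl eps (cond_pos eps)) as [d hd].
  exists d; intros y hy hy0; apply hd; [exact hy0|].
  unfold ball in hy; simpl in hy.
  unfold AbsRing_ball, abs, minus, plus, opp in hy; simpl in hy.
  now rewrite Ropp_0, Rplus_0_r in hy. }
assert (L2 : is_lim (fun e => g (t + e))%R 0%R (g t)).
{ unfold is_lim; simpl.
  apply (filterlim_filter_le_1 _ (filter_le_within _)).
  assert (c : continuous (fun e => g (t + e))%R 0%R).
  { apply (continuous_comp (fun e => t + e)%R g).
    - apply (continuous_plus (fun _ => t) (fun e => e));
        [apply continuous_const|apply continuous_id].
    - rewrite Rplus_0_r; exact hg. }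
  unfold continuous in c; rewrite Rplus_0_r in c; exact c. }
assert (L := is_lim_mult _ _ _ _ _ L1 L2 I).
apply is_lim_spec in L.
intros eps he; destruct (L (mkposreal eps he)) as [d hd].
exists d; intros e he0 hed.
rewrite h0, Rmult_0_l, Rminus_0_r.
replace (h (t + e) * g (t + e) / e)%R
  with ((h (t + e) - h t) / e * g (t + e))%R
  by (rewrite h0; field; exact he0).
apply hd; [|exact he0].
unfold ball; simpl; unfold AbsRing_ball, abs, minus, plus, opp; simpl.
now rewrite Ropp_0, Rplus_0_r.
Qed.

Lemma derivC_eq (f : R -> C) (t : R) (l l' : C) :
  is_derivC f t l -> l = l' -> is_derivC f t l'.
Proof. intros h <-; exact h. Qed.

Lemma derivC_const (c : C) (t : R) : is_derivC (fun _ => c) t 0.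
Proof. exact (is_derive_const (K := R_AbsRing) (V := C_R_NormedModule) c t). Qed.

Lemma derivC_plus (f g : R -> C) (t : R) (l m : C) :
  is_derivC f t l -> is_derivC g t m -> is_derivC (fun z => f z + g z) t (l + m).
Proof. exact (is_derive_plus (K := R_AbsRing) (V := C_R_NormedModule) f g t l m). Qed.

Lemma derivC_opp (f : R -> C) (t : R) (l : C) :
  is_derivC f t l -> is_derivC (fun z => - f z) t (- l).
Proof. exact (is_derive_opp (K := R_AbsRing) (V := C_R_NormedModule) f t l). Qed.

Lemma derivC_minus (f g : R -> C) (t : R) (l m : C) :
  is_derivC f t l -> is_derivC g t m -> is_derivC (fun z => f z - g z) t (l - m).
Proof. exact (is_derive_minus (K := R_AbsRing) (V := C_R_NormedModule) f g t l m). Qed.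

Lemma derivC_mult (f g : R -> C) (t : R) (l m : C) :
  is_derivC f t l -> is_derivC g t m ->
  is_derivC (fun z => f z * g z) t (l * g t + f t * m).
Proof.
intros hf hg; apply derivC_pair in hf; apply derivC_pair in hg.
destruct hf as [f1 f2]; destruct hg as [g1 g2].
apply derivC_pair; split; cbn.
- replace (fst l * fst (g t) - snd l * snd (g t)
    + (fst (f t) * fst m - snd (f t) * snd m))%R
    with ((fst l * fst (g t) + fst (f t) * fst m)
      - (snd l * snd (g t) + snd (f t) * snd m))%R by ring.
  apply (is_derive_minus (fun z => fst (f z) * fst (g z))%R
    (fun z => snd (f z) * snd (g z))%R); now apply Derive.is_derive_mult.
- replace (fst l * snd (g t) + snd l * fst (g t)
    + (fst (f t) * snd m + snd (f t) * fst m))%R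
    with ((fst l * snd (g t) + fst (f t) * snd m)
      + (snd l * fst (g t) + snd (f t) * fst m))%R by ring.
  apply (is_derive_plus (fun z => fst (f z) * snd (g z))%R
    (fun z => snd (f z) * fst (g z))%R); now apply Derive.is_derive_mult.
Qed.

Lemma derivC_zero_mult (f g : R -> C) (t : R) (l : C) :
  f t = 0 -> is_derivC f t l -> contC g t ->
  is_derivC (fun z => f z * g z) t (l * g t).
Proof.
intros f0 hf hg; apply derivC_pair in hf; apply contC_pair in hg.
destruct hf as [f1 f2]; destruct hg as [g1 g2].
apply derivC_pair; split; cbn.
- apply (is_derive_minus (fun z => fst (f z) * fst (g z))%R
    (fun z => snd (f z) * snd (g z))%R);
    apply is_derive_zero_mult; auto; now rewrite f0.
- apply (is_derive_plus (fun z => fst (f z) * snd (g z))%R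
    (fun z => snd (f z) * fst (g z))%R);
    apply is_derive_zero_mult; auto; now rewrite f0.
Qed.

Lemma derivC_sqr (f : R -> C) (t : R) (l : C) :
  is_derivC f t l -> is_derivC (fun z => f z ^ 2) t (2 * f t * l).
Proof.
intros h; apply (is_derive_ext (fun z => f z * f z)).
{ intros z; change (f z * f z = f z ^ 2); ring. }
eapply derivC_eq; [apply derivC_mult; exact h|ring].
Qed.

Lemma derivC_cont (f : R -> C) (t : R) (l : C) : is_derivC f t l -> contC f t.
Proof.
intros h.
apply (ex_derive_continuous (K := R_AbsRing) (V := C_R_NormedModule)).
exists l; exact h.
Qed.

Lemma contC_const (c : C) (t : R) : contC (fun _ => c) t.
Proof. apply continuous_const. Qed.

Lemma contC_plus (f g : R -> C) (t : R) :
  contC f t -> contC g t -> contC (fun z => f z + g z) t.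
Proof. exact (continuous_plus (V := C_R_NormedModule) f g t). Qed.

Lemma contC_opp (f : R -> C) (t : R) :
  contC f t -> contC (fun z => - f z) t.
Proof. exact (continuous_opp (V := C_R_NormedModule) f t). Qed.

Lemma contC_mult (f g : R -> C) (t : R) :
  contC f t -> contC g t -> contC (fun z => f z * g z) t.
Proof.
intros hf hg; apply contC_pair in hf; apply contC_pair in hg.
destruct hf as [f1 f2]; destruct hg as [g1 g2].
apply contC_pair; split; cbn.
- apply (continuous_minus (fun z => fst (f z) * fst (g z))%R
    (fun z => snd (f z) * snd (g z))%R);
    now apply (continuous_mult (K := R_AbsRing)).
- apply (continuous_plus (fun z => fst (f z) * snd (g z))%R
    (fun z => snd (f z) * fst (g z))%R);
    now apply (continuous_mult (K := R_AbsRing)).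
Qed.

Lemma contC_inv (f : R -> C) (t : R) :
  f t <> 0 -> contC f t -> contC (fun z => / f z) t.
Proof.
intros f0 hf; apply contC_pair in hf; destruct hf as [f1 f2].
assert (c : continuous (fun z => / (fst (f z) ^ 2 + snd (f z) ^ 2))%R t).
{ apply continuous_Rinv_comp.
  - apply (continuous_ext
      (fun z => fst (f z) * fst (f z) + snd (f z) * snd (f z))%R);
      [intros z; cbn; ring|].
    apply (continuous_plus (fun z => fst (f z) * fst (f z))%R
      (fun z => snd (f z) * snd (f z))%R);
      now apply (continuous_mult (K := R_AbsRing)).
  - intros h; apply f0; apply injective_projections; cbn; nra. }
apply contC_pair; split; cbn -[pow].
- now apply (continuous_mult (K := R_AbsRing) (fun z => fst (f z))).
- apply (continuous_mult (K := R_AbsRing) (fun z => - snd (f z))%R);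
    [now apply (continuous_opp (fun z => snd (f z)))|exact c].
Qed.

Lemma contC_neq_0 (f : R -> C) (t : R) :
  f t <> 0 -> contC f t -> locally t (fun z => f z <> 0).
Proof.
intros f0 hf; apply contC_pair in hf; destruct hf as [f1 f2].
destruct (Req_dec (fst (f t)) 0) as [h1|h1].
- assert (h2 : snd (f t) <> 0%R).
  { intros h2; apply f0; now apply injective_projections. }
  assert (e : locally t (fun z => snd (f z) <> 0%R))
    by exact (f2 _ (open_neq 0%R _ h2)).
  revert e; apply filter_imp.
  intros z hz h; apply hz; now rewrite h.
- assert (e : locally t (fun z => fst (f z) <> 0%R))
    by exact (f1 _ (open_neq 0%R _ h1)).
  revert e; apply filter_imp.
  intros z hz h; apply hz; now rewrite h.
Qed.

(** The quotient is a product with [1/g], and near [t] one has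
    [1/g = 1/g(t) - (g - g(t)) / (g g(t))], where the factor [g - g(t)] vanishes at [t]. *)
Lemma derivC_div (f g : R -> C) (t : R) (l m : C) :
  g t <> 0 -> is_derivC f t l -> is_derivC g t m ->
  is_derivC (fun z => f z / g z) t ((l * g t - f t * m) / g t ^ 2).
Proof.
intros g0 hf hg.
assert (cg := derivC_cont _ _ _ hg).
assert (hi : is_derivC (fun z => / g z) t (- m / g t ^ 2)).
{ apply (is_derive_ext_loc
    (fun z => / g t + (g z - g t) * - / (g z * g t))).
  - generalize (contC_neq_0 _ _ g0 cg); apply filter_imp.
    intros z hz; change (/ g t + (g z - g t) * - / (g z * g t) = / g z).
    field; auto.
  - eapply derivC_eq.
    + apply derivC_plus; [apply derivC_const|].
      apply derivC_zero_mult.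
      * ring.
      * apply derivC_minus; [exact hg|apply derivC_const].
      * apply contC_opp, contC_inv.
        -- now apply Cmult_neq_0.
        -- apply contC_mult; [exact cg|apply contC_const].
    + cbn beta; field; exact g0. }
eapply derivC_eq; [exact (derivC_mult _ _ _ _ _ hf hi)|cbn beta; field; exact g0].
Qed.

Lemma derivC_sqrt (h w : R -> C) (t : R) (l : C) :
  w t <> 0 -> contC w t -> locally t (fun z => w z ^ 2 = h z) ->
  is_derivC h t l -> is_derivC w t (l / (2 * w t)).
Proof.
intros w0 cw hw hh.
assert (w2 : w t + w t <> 0).
{ replace (w t + w t) with (2 * w t) by ring.
  apply Cmult_neq_0; [apply RtoC_neq_0; lra|exact w0]. }
assert (cs : contC (fun z => w z + w t) t)
  by (apply contC_plus; [exact cw|apply contC_const]).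
apply (is_derive_ext_loc (fun z => w t + (h z - h t) * / (w z + w t))).
- generalize (filter_and _ _ hw (contC_neq_0 _ _ w2 cs)); apply filter_imp.
  intros z [hz hz0].
  change (w t + (h z - h t) * / (w z + w t) = w z).
  rewrite <- hz, <- (locally_singleton _ _ hw); field; exact hz0.
- eapply derivC_eq.
  + apply derivC_plus; [apply derivC_const|].
    apply derivC_zero_mult.
    * ring.
    * apply derivC_minus; [exact hh|apply derivC_const].
    * now apply contC_inv.
  + cbn beta; field; split; assumption.
Qed.

(** Meant for goals whose derivative is still an existential variable, which the rules fill in.
    Constants are tried first, so that parameters get derivative 0. *)
Ltac derivC_rule :=
  lazymatch goal with
  | |- is_derivC (fun _ => ?c) _ _ => apply (derivC_const c)
  | |- is_derivC (fun z => @?f z + @?g z) _ _ => apply (derivC_plus f g)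
  | |- is_derivC (fun z => @?f z - @?g z) _ _ => apply (derivC_minus f g)
  | |- is_derivC (fun z => - @?f z) _ _ => apply (derivC_opp f)
  | |- is_derivC (fun z => @?f z * @?g z) _ _ => apply (derivC_mult f g)
  | |- is_derivC (fun z => @?f z ^ 2) _ _ => apply (derivC_sqr f)
  | |- _ => eassumption
  end.

(** Differentiating [A s^2 + B s + D = 0] gives [(2 A s + B) s' = - (a s^2 + b s + d)], and
    [2 A s + B = w] at this root. *)
Lemma derivC_quadratic_root (A B D w : R -> C) (t : R) (a b d : C) :
  is_derivC A t a -> is_derivC B t b -> is_derivC D t d ->
  A t <> 0 -> w t <> 0 -> contC w t ->
  locally t (fun z => w z ^ 2 = B z ^ 2 - 4 * A z * D z) ->
  let s z := (- B z + w z) / (2 * A z) in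
  is_derivC s t (- (a * s t ^ 2 + b * s t + d) / w t).
Proof.
intros hA hB hD A0 w0 cw hw s.
assert (h2 : RtoC 2 <> 0) by (apply RtoC_neq_0; lra).
eapply derivC_eq.
- apply (derivC_div (fun z => - B z + w z) (fun z => 2 * A z)).
  + now apply Cmult_neq_0.
  + apply derivC_plus; [apply derivC_opp; exact hB|].
    eapply derivC_sqrt; [exact w0|exact cw|exact hw|].
    repeat derivC_rule.
  + repeat derivC_rule.
- assert (e := locally_singleton _ _ hw); cbn beta in e.
  assert (eD : D t = (B t ^ 2 - w t ^ 2) / (4 * A t)).
  { rewrite e; field; auto. }
  unfold s; rewrite eD; field; auto.
Qed.

(** * Polynomial identities on the invariant relations *)

Section Algebra.
Variables g2 g3 k : C.

(* The derivative of F(x1, x2, s) in x1; as F is symmetric in x1 and x2, its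
   derivative in x2 is [dF x2 x1 s]. *)
Definition dF (x1 x2 s : C) : C :=
  2 * (x1 - x2) * s ^ 2 + (- (4 * x1 * x2) - 2 * x2 ^ 2 + g2 / 2) * s
  + 2 * x1 * x2 ^ 2 + g2 / 2 * x2 + g3.

(* Implicit differentiation of F(x1, x2, s) = 0 along the flow gives
   F_s s' = i/2 (F_x1 u1 - F_x2 u2), where u1 = 2 i x1' and u2 = - 2 i x2'; the
   ordinate is y = - i F_s s' / A. *)
Definition yF (x1 x2 u1 u2 s : C) : C :=
  (dF x1 x2 s * u1 - dF x2 x1 s * u2) / (2 * coefA x1 x2).

Section Relations.
Variables x1 x2 e1 e2 u1 u2 s : C.
Hypothesis hA : coefA x1 x2 <> 0.
Hypothesis hu1 : u1 ^ 2 = polP g2 g3 x1 + e1 * coefA x1 x2.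
Hypothesis hu2 : u2 ^ 2 = polP g2 g3 x2 + e2 * coefA x1 x2.
Hypothesis hu12 : 2 * u1 * u2 = - coefB g2 g3 x1 x2.
Hypothesis hk : e1 * e2 = k ^ 2.
Hypothesis hF : polF g2 g3 x1 x2 s = 0.

(** Discriminant separability: the discriminant in [s] splits into a function of [x1] times the same
    function of [x2]. *)
Lemma discF_polP :
  discF g2 g3 x1 x2 = 4 * polP g2 g3 x1 * polP g2 g3 x2.
Proof.
unfold discF, coefA, coefB, coefC, polP; field.
Qed.

(** Multiply [e1 A = u1^2 - P(x1)] by [e2 A = u2^2 - P(x2)]. The product [u1 u2] is known through
    [B], and [B^2 - 4 P(x1) P(x2) = 4 A C], so a factor [4 A] cancels. *)
Lemma relation_k :
  coefA x1 x2 * k ^ 2 =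
  coefC g2 g3 x1 x2 - e1 * polP g2 g3 x2 - e2 * polP g2 g3 x1.
Proof.
apply (Cmult_cancel_l (4 * coefA x1 x2)).
{ apply Cmult_neq_0; [apply RtoC_neq_0; lra|exact hA]. }
rewrite <- hk.
transitivity (4 * (u1 ^ 2 - polP g2 g3 x1) * (u2 ^ 2 - polP g2 g3 x2)).
{ rewrite hu1, hu2; ring. }
transitivity ((2 * u1 * u2) ^ 2 - 4 * u1 ^ 2 * polP g2 g3 x2
   - 4 * u2 ^ 2 * polP g2 g3 x1 + 4 * polP g2 g3 x1 * polP g2 g3 x2); [ring|].
rewrite hu12, hu1, hu2.
assert (h := discF_polP); unfold discF in h.
transitivity (coefB g2 g3 x1 x2 ^ 2 - 4 * polP g2 g3 x1 * polP g2 g3 x2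
 - 4 * coefA x1 x2 * (e1 * polP g2 g3 x2 + e2 * polP g2 g3 x1)); [ring|].
rewrite <- h; ring.
Qed.

(* In h = g2/4 the relation F = 0 is monic quadratic, so rewriting h * h and the
   products of u1, u2 reduces polynomials to normal form. *)
Lemma scaled_relations : exists h m : C,
  g2 = 4 * h /\ g3 = 2 * m /\
  h * h = - ((x1 - x2) ^ 2 * s ^ 2
    + (- (2 * x1 * x2 * (x1 + x2)) + 2 * h * (x1 + x2) + 2 * m) * s
    + x1 ^ 2 * x2 ^ 2 + 2 * h * x1 * x2 + 2 * m * (x1 + x2)) /\
  u1 * u1 = 2 * x1 ^ 3 - 2 * h * x1 - m + e1 * (x1 - x2) ^ 2 /\
  u2 * u2 = 2 * x2 ^ 3 - 2 * h * x2 - m + e2 * (x1 - x2) ^ 2 /\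
  u1 * u2 = x1 * x2 * (x1 + x2) - h * (x1 + x2) - m.
Proof.
exists (g2 / 4), (g3 / 2); repeat split.
- field.
- field.
- rewrite <- (Cplus_0_r (- _)), <- hF; unfold polF, coefA, coefB, coefC; field.
- replace (u1 * u1) with (u1 ^ 2) by ring.
  rewrite hu1; unfold polP, coefA; field.
- replace (u2 * u2) with (u2 ^ 2) by ring.
  rewrite hu2; unfold polP, coefA; field.
- apply (Cmult_cancel_l 2); [apply RtoC_neq_0; lra|].
  rewrite Cmult_assoc, hu12; unfold coefB; field.
Qed.

Lemma yF_sq : yF x1 x2 u1 u2 s ^ 2 = Phi g2 g3 k s.
Proof.
apply (Cmult_cancel_l (4 * coefA x1 x2 ^ 2)).
{ apply Cmult_neq_0; [apply RtoC_neq_0; lra|apply Cpow_nz, hA]. }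
transitivity ((dF x1 x2 s * u1 - dF x2 x1 s * u2) ^ 2).
{ unfold yF; field; exact hA. }
(* One factor [A] is moved into [s^2 - k^2], so that [k] occurs only in [A k^2], which [relation_k]
   eliminates. *)
transitivity (4 * coefA x1 x2 * polP g2 g3 s
  * (coefA x1 x2 * s ^ 2 - coefA x1 x2 * k ^ 2)).
2: { unfold Phi; ring. }
rewrite relation_k.
unfold dF, polP, coefA, coefC.
destruct scaled_relations as (h & m & -> & -> & hh & h1 & h2 & h12).
field [hh h1 h2 h12].
Qed.

(* The left side is, up to a factor, the derivative of [yF] along the flow,
   where s' is eliminated by F_s s' = i A y.  Obtaining y' from the
   equations of motion rather than from y^2 = Phi(s) covers the zeros of y. *)
Lemma yF_deriv_identity :
  let P' z := 6 * z ^ 2 - g2 / 2 in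
  let d := x1 - x2 in
  let G := 2 * coefA x1 x2 * s + coefB g2 g3 x1 x2 in
  let Faa := 2 * s ^ 2 - 4 * x2 * s + 2 * x2 ^ 2 in
  let Fbb := 2 * s ^ 2 - 4 * x1 * s + 2 * x1 ^ 2 in
  let Fab := - (2 * s ^ 2) - 4 * (x1 + x2) * s + 4 * x1 * x2 + g2 / 2 in
  let Fas := 4 * d * s - 4 * x1 * x2 - 2 * x2 ^ 2 + g2 / 2 in
  let Fbs := - (4 * d * s) - 4 * x1 * x2 - 2 * x1 ^ 2 + g2 / 2 in
  let Fa := dF x1 x2 s in
  let Fb := dF x2 x1 s in
  2 * d * G *
    (u1 * (Fab * u2 - Faa * u1) - u2 * (Fbb * u2 - Fab * u1)
     - 2 * Fa * (P' x1 / 4 + e1 * d) - 2 * Fb * (P' x2 / 4 - e2 * d))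
  + 2 * d * (Fas * u1 - Fbs * u2) * (Fa * u1 - Fb * u2)
  + 4 * G * (u1 + u2) * (Fa * u1 - Fb * u2)
  = 4 * d * coefA x1 x2 ^ 2 * dPhi g2 g3 k s.
Proof.
cbv zeta.
transitivity (4 * (x1 - x2) * coefA x1 x2 * ((6 * s ^ 2 - g2 / 2)
  * (coefA x1 x2 * s ^ 2 - coefA x1 x2 * k ^ 2)
  + coefA x1 x2 * polP g2 g3 s * (2 * s))).
2: { unfold dPhi; field. }
rewrite relation_k.
unfold dF, polP, coefA, coefB, coefC.
destruct scaled_relations as (h & m & -> & -> & hh & h1 & h2 & h12).
field [hh h1 h2 h12].
Qed.

End Relations.

(** * The momenta u1 and u2: quadratic relations and derivatives along the flow *)

Section Motion.
Variables x1 x2 e1 e2 r gam : C.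
Hypothesis hS : x1 + x2 <> 0.
Hypothesis hinv : invariant_relations g2 g3 k x1 x2 e1 e2 r gam.

(** The expanded square contains [r] and [gam] only through [r^2], [r gam] and [gam^2], which are
    the quantities given by the invariant relations. *)
Lemma momentum1_sq :
  (x1 ^ 2 * r + gam) ^ 2 = polP g2 g3 x1 + e1 * coefA x1 x2.
Proof.
destruct hinv as (h1 & h2 & h3 & _).
transitivity (x1 ^ 4 * r ^ 2 + 2 * x1 ^ 2 * (r * gam) + gam ^ 2); [ring|].
rewrite h1, h2, h3; unfold polP, coefA; field; exact hS.
Qed.

Lemma momentum2_sq :
  (x2 ^ 2 * r + gam) ^ 2 = polP g2 g3 x2 + e2 * coefA x1 x2.
Proof.
destruct hinv as (h1 & h2 & h3 & _).
transitivity (x2 ^ 4 * r ^ 2 + 2 * x2 ^ 2 * (r * gam) + gam ^ 2); [ring|].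
rewrite h1, h2, h3; unfold polP, coefA; field; exact hS.
Qed.

Lemma momentum_mul :
  2 * (x1 ^ 2 * r + gam) * (x2 ^ 2 * r + gam) = - coefB g2 g3 x1 x2.
Proof.
destruct hinv as (h1 & h2 & h3 & _).
transitivity (2 * (x1 ^ 2 * x2 ^ 2 * r ^ 2
  + (x1 ^ 2 + x2 ^ 2) * (r * gam) + gam ^ 2)); [ring|].
rewrite h1, h2, h3; unfold coefB; field; exact hS.
Qed.

Let r' := Ci / 2 * ((x1 ^ 2 - x2 ^ 2 + 2 * e2 * x1 - 2 * e1 * x2)
                    / (x1 + x2) ^ 2).
Let gam' := - (Ci / 8) * ((g2 * (x1 ^ 2 - x2 ^ 2)
                      + 8 * e2 * x1 ^ 3 - 8 * e1 * x2 ^ 3)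
                     / (x1 + x2) ^ 2).

(** The left side is u1' by the product rule and the equations of motion. Eliminating [r^2] and
    [r gam] leaves [- i (P'(x1)/4 + e1 (x1 - x2))], free of [r] and [gam]. *)
Lemma momentum1_deriv :
  2 * x1 * (- (Ci / 2) * (x1 ^ 2 * r + gam)) * r + x1 ^ 2 * r' + gam' =
  - Ci * ((6 * x1 ^ 2 - g2 / 2) / 4 + e1 * (x1 - x2)).
Proof.
destruct hinv as (h1 & h2 & _ & _).
transitivity (- Ci * x1 * (x1 ^ 2 * r ^ 2 + r * gam) + x1 ^ 2 * r' + gam');
  [field|].
rewrite h1, h2; unfold r', gam'; field; exact hS.
Qed.

Lemma momentum2_deriv :
  2 * x2 * (Ci / 2 * (x2 ^ 2 * r + gam)) * r + x2 ^ 2 * r' + gam' =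
  Ci * ((6 * x2 ^ 2 - g2 / 2) / 4 - e2 * (x1 - x2)).
Proof.
destruct hinv as (h1 & h2 & _ & _).
transitivity (Ci * x2 * (x2 ^ 2 * r ^ 2 + r * gam) + x2 ^ 2 * r' + gam');
  [field|].
rewrite h1, h2; unfold r', gam'; field; exact hS.
Qed.

End Motion.
End Algebra.

(** * Motion of one root of F on the curve *)

(** The branch [w] is arbitrary, so the lemma serves both roots, with [w] and [- w]. The conclusion
    is the condition on an arc required by [arc_integral]. *)
Lemma separating_root (g2 g3 k : C) (I : R -> Prop)
    (x1 x2 e1 e2 r gam w s : R -> C) :
  open I ->
  equations_of_motion g2 I x1 x2 e1 e2 r gam ->
  (forall t : R, I t ->
     invariant_relations g2 g3 k (x1 t) (x2 t) (e1 t) (e2 t) (r t) (gam t)) ->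
  (forall t : R, I t -> x1 t + x2 t <> 0) ->
  (forall t : R, I t -> coefA (x1 t) (x2 t) <> 0) ->
  (forall t : R, I t -> discF g2 g3 (x1 t) (x2 t) <> 0) ->
  sqrt_branch I (fun t => discF g2 g3 (x1 t) (x2 t)) w ->
  (forall t : R, I t -> s t = rootF g2 g3 (x1 t) (x2 t) (w t)) ->
  let y t := yF g2 g3 (x1 t) (x2 t) (x1 t ^ 2 * r t + gam t)
               (x2 t ^ 2 * r t + gam t) (s t) in
  let v t := Ci * coefA (x1 t) (x2 t) / w t in
  forall t : R, I t ->
    y t ^ 2 = Phi g2 g3 k (s t) /\
    is_derivC s t (y t * v t) /\
    is_derivC y t (dPhi g2 g3 k (s t) * v t / 2) /\
    contC v t.
Proof.
intros oI hm hinv hS hA hD hw hs y v t It.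
destruct (hm t It) as (dx1 & dx2 & _ & _ & dr & dgam).
specialize (hinv t It); specialize (hS t It).
assert (A0 := hA t It).
destruct (hw t It) as [cw hw2]; cbn beta in hw2.
assert (w0 : w t <> 0).
{ intros h; apply (hD t It); rewrite <- hw2, h; ring. }
assert (It' : locally t I) by exact (oI t It).
pose (u1 := fun t => x1 t ^ 2 * r t + gam t).
pose (u2 := fun t => x2 t ^ 2 * r t + gam t).
assert (hu1 := momentum1_sq _ _ _ _ _ _ _ _ _ hS hinv).
assert (hu2 := momentum2_sq _ _ _ _ _ _ _ _ _ hS hinv).
assert (hu12 := momentum_mul _ _ _ _ _ _ _ _ _ hS hinv).
assert (hk : e1 t * e2 t = k ^ 2) by apply hinv.
assert (hF : polF g2 g3 (x1 t) (x2 t) (s t) = 0).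
{ rewrite (rootF_spec _ _ _ _ _ A0 hw2), <- (hs t It); ring. }
(* At the root, [w] is the partial derivative of F in [s]. *)
assert (hG : w t = 2 * coefA (x1 t) (x2 t) * s t + coefB g2 g3 (x1 t) (x2 t)).
{ rewrite (hs t It); unfold rootF; field; exact A0. }
assert (du1 : is_derivC u1 t
  (- Ci * ((6 * x1 t ^ 2 - g2 / 2) / 4 + e1 t * (x1 t - x2 t)))).
{ eapply derivC_eq; [unfold u1; repeat derivC_rule|].
  rewrite <- (momentum1_deriv _ _ _ _ _ _ _ _ _ hS hinv); ring. }
assert (du2 : is_derivC u2 t
  (Ci * ((6 * x2 t ^ 2 - g2 / 2) / 4 - e2 t * (x1 t - x2 t)))).
{ eapply derivC_eq; [unfold u2; repeat derivC_rule|].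
  rewrite <- (momentum2_deriv _ _ _ _ _ _ _ _ _ hS hinv); ring. }
change (is_derivC x1 t (- (Ci / 2) * u1 t)) in dx1.
change (is_derivC x2 t (Ci / 2 * u2 t)) in dx2.
change (u1 t ^ 2 = polP g2 g3 (x1 t) + e1 t * coefA (x1 t) (x2 t)) in hu1.
change (u2 t ^ 2 = polP g2 g3 (x2 t) + e2 t * coefA (x1 t) (x2 t)) in hu2.
change (2 * u1 t * u2 t = - coefB g2 g3 (x1 t) (x2 t)) in hu12.
subst y.
change (let y := fun t => yF g2 g3 (x1 t) (x2 t) (u1 t) (u2 t) (s t) in
  y t ^ 2 = Phi g2 g3 k (s t) /\ is_derivC s t (y t * v t) /\
  is_derivC y t (dPhi g2 g3 k (s t) * v t / 2) /\ contC v t).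
(* From here only the squares, the product and the derivatives of the momenta matter. *)
clearbody u1 u2; intros y.
assert (ds : is_derivC s t (y t * v t)).
{ apply (is_derive_ext_loc
    (fun t => rootF g2 g3 (x1 t) (x2 t) (w t))).
  { revert It'; apply filter_imp; intros z hz; symmetry; auto. }
  eapply derivC_eq.
  - apply (derivC_quadratic_root (fun t => coefA (x1 t) (x2 t))
      (fun t => coefB g2 g3 (x1 t) (x2 t))
      (fun t => coefC g2 g3 (x1 t) (x2 t)) w).
    + unfold coefA; repeat derivC_rule.
    + unfold coefB; repeat derivC_rule.
    + unfold coefC; repeat derivC_rule.
    + exact A0.
    + exact w0.
    + exact cw.
    + revert It'; apply filter_imp; intros z hz; exact (proj2 (hw z hz)).
  - cbn beta.
    change ((- coefB g2 g3 (x1 t) (x2 t) + w t) / (2 * coefA (x1 t) (x2 t)))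
      with (rootF g2 g3 (x1 t) (x2 t) (w t)).
    rewrite <- (hs t It).
    unfold y, v, yF, dF; field; auto. }
split; [|split; [exact ds|split]].
- exact (yF_sq _ _ _ _ _ _ _ _ _ _ A0 hu1 hu2 hu12 hk hF).
- assert (id := yF_deriv_identity _ _ _ _ _ _ _ _ _ _ A0 hu1 hu2 hu12 hk hF).
  cbv zeta in id; rewrite <- hG in id.
  eapply derivC_eq.
  + apply (derivC_div
      (fun t => dF g2 g3 (x1 t) (x2 t) (s t) * u1 t
              - dF g2 g3 (x2 t) (x1 t) (s t) * u2 t)
      (fun t => 2 * coefA (x1 t) (x2 t))).
    * apply Cmult_neq_0; [apply RtoC_neq_0; lra|exact A0].
    * unfold dF; repeat derivC_rule.
    * unfold coefA; repeat derivC_rule.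
  + cbn beta.
    assert (d0 : x1 t - x2 t <> 0).
    { intros h; apply A0; unfold coefA; rewrite h; ring. }
    (* This factor turns the expected derivative into the right side of [yF_deriv_identity] times
       [v/2]. *)
    apply (Cmult_cancel_l (4 * (x1 t - x2 t) * coefA (x1 t) (x2 t) ^ 2)).
    { apply Cmult_neq_0; [apply Cmult_neq_0; [apply RtoC_neq_0; lra|exact d0]|].
      apply Cpow_nz, A0. }
    transitivity (4 * (x1 t - x2 t) * coefA (x1 t) (x2 t) ^ 2
      * dPhi g2 g3 k (s t) * (v t / 2)); [|field].
    rewrite <- id; clear id.
    unfold y, v, yF, dF, coefA; field; auto.
- unfold v.
  apply contC_mult.
  + eapply (derivC_cont (fun t => Ci * coefA (x1 t) (x2 t)) t).
    unfold coefA; repeat derivC_rule.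
  + now apply contC_inv.
Qed.

(** * Integrals along arcs and linear motion on the Jacobian *)

Lemma intC_exists (f : R -> C) (a b : R) :
  (forall t : R, (Rmin a b <= t <= Rmax a b)%R -> contC f t) ->
  exists l : C, is_intC f a b l.
Proof.
intros hf.
exists (RInt (fun t => fst (f t)) a b, RInt (fun t => snd (f t)) a b).
apply (is_RInt_fct_extend_pair (U := R_NormedModule) (V := R_NormedModule));
  apply (RInt_correct (V := R_CompleteNormedModule));
  apply (ex_RInt_continuous (V := R_CompleteNormedModule));
  intros t ht; apply (contC_pair f t); auto.
Qed.

Definition opp2 (u : C * C) : C * C := (- fst u, - snd u).

Section Paths.
Variables f df : C -> C.

(** The arc itself is kept: its conditions are symmetric in [a] and [b], and swapping the bounds
    negates both integrals. *)
Lemma arc_integral_rev (p q u : C * C) :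
  arc_integral f df p q u -> arc_integral f df q p (opp2 u).
Proof.
intros (a & b & s & y & v & h & hp & hq & h1 & h2).
exists b, a, s, y, v; split.
- rewrite Rmin_comm, Rmax_comm; exact h.
- split; [exact hq|split; [exact hp|split]].
  + exact (is_RInt_swap (V := C_R_NormedModule) _ _ _ _ h1).
  + exact (is_RInt_swap (V := C_R_NormedModule) _ _ _ _ h2).
Qed.

Lemma path_integral_rev (p q u : C * C) :
  path_integral f df p q u -> path_integral f df q p (opp2 u).
Proof.
induction 1 as [p q u h | p q r u v _ hu _ hv].
- now apply path_arc, arc_integral_rev.
- replace (opp2 (add2 u v)) with (add2 (opp2 v) (opp2 u)).
  + now apply path_cat with q.
  + unfold opp2, add2; cbn; f_equal; ring.
Qed.

(** The motions of the two points are themselves arcs of the curve. Their integrals add up to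
    [(t - t0) (c1, c2)], since the summed integrands are constant. *)
Lemma linear_of_constant_velocity (I : R -> Prop) (s1 y1 v1 s2 y2 v2 : R -> C)
    (c1 c2 : C) :
  (forall a b t : R, I a -> I b -> (Rmin a b <= t <= Rmax a b)%R -> I t) ->
  (forall t : R, I t ->
     y1 t ^ 2 = f (s1 t) /\ is_derivC s1 t (y1 t * v1 t) /\
     is_derivC y1 t (df (s1 t) * v1 t / 2) /\ contC v1 t) ->
  (forall t : R, I t ->
     y2 t ^ 2 = f (s2 t) /\ is_derivC s2 t (y2 t * v2 t) /\
     is_derivC y2 t (df (s2 t) * v2 t / 2) /\ contC v2 t) ->
  (forall t : R, I t -> v1 t + v2 t = c1) ->
  (forall t : R, I t -> s1 t * v1 t + s2 t * v2 t = c2) ->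
  linear_on_jacobian f df I (fun t => (s1 t, y1 t)) (fun t => (s2 t, y2 t))
    (c1, c2).
Proof.
intros hI h1 h2 hc1 hc2 p1 p2 t0 t u0 I0 It [V1 [V2 [hV1 [hV2 ->]]]].
assert (hseg : forall z, (Rmin t0 t <= z <= Rmax t0 t)%R -> I z)
  by (intros z; now apply hI).
destruct (intC_exists v1 t0 t) as [a1 ha1].
{ intros z hz; apply h1, hseg, hz. }
destruct (intC_exists (fun z => s1 z * v1 z) t0 t) as [b1 hb1].
{ intros z hz; destruct (h1 z (hseg z hz)) as (_ & d & _ & c).
  exact (contC_mult _ _ _ (derivC_cont _ _ _ d) c). }
(* The integrals for the second point are those of a constant minus those for the first, which makes
   the sum of [W1] and [W2] exactly linear in [t]. *)
assert (hdiff : forall (g g' : R -> C) (c l : C), is_intC g t0 t l ->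
  (forall z, (Rmin t0 t <= z <= Rmax t0 t)%R -> g z + g' z = c) ->
  is_intC g' t0 t (RtoC (t - t0) * c - l)).
{ intros g g' c l hg hs.
  rewrite <- scal_R_Cmult.
  apply (is_RInt_ext (V := C_R_NormedModule) (fun z => c - g z)).
  - intros z hz; change (c - g z = g' z).
    rewrite <- (hs z); [ring|lra].
  - apply (is_RInt_minus (V := C_R_NormedModule) (fun _ => c)); [|exact hg].
    exact (is_RInt_const (V := C_R_NormedModule) t0 t c). }
assert (ha2 := hdiff v1 v2 c1 a1 ha1 (fun z hz => hc1 z (hseg z hz))).
assert (hb2 := hdiff _ (fun z => s2 z * v2 z) c2 b1 hb1
  (fun z hz => hc2 z (hseg z hz))).
set (W1 := (a1, b1)).
set (W2 := (RtoC (t - t0) * c1 - a1, RtoC (t - t0) * c2 - b1)).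
assert (hW1 : path_integral f df (s1 t0, y1 t0) (s1 t, y1 t) W1).
{ apply path_arc; exists t0, t, s1, y1, v1.
  split; [intros z hz; exact (h1 z (hseg z hz))|].
  split; [reflexivity|split; [reflexivity|split; assumption]]. }
assert (hW2 : path_integral f df (s2 t0, y2 t0) (s2 t, y2 t) W2).
{ apply path_arc; exists t0, t, s2, y2, v2.
  split; [intros z hz; exact (h2 z (hseg z hz))|].
  split; [reflexivity|split; [reflexivity|split; assumption]]. }
split.
(* Prolonging the given paths by the flow arcs provides a value of the Abel map at time [t]. *)
- exists (add2 (add2 V1 W1) (add2 V2 W2)), (add2 V1 W1), (add2 V2 W2).
  split; [|split; [|reflexivity]].
  + now apply path_cat with (s1 t0, y1 t0).
  + now apply path_cat with (s2 t0, y2 t0).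
- intros u [U1 [U2 [hU1 [hU2 ->]]]].
  unfold jacobian_eq.
  (* Each summand belongs to a loop: out along [U1] or [U2], back along the flow arc, then back
     along [V1] or [V2]. *)
  replace (sub2 _ _) with
    (add2 (add2 U1 (add2 (opp2 W1) (opp2 V1)))
          (add2 U2 (add2 (opp2 W2) (opp2 V2)))).
  2: { unfold sub2, add2, opp2, W1, W2; cbn [fst snd]; f_equal; ring. }
  apply period_add; [apply period_loop with p1|apply period_loop with p2].
  + apply path_cat with (s1 t, y1 t); [exact hU1|].
    apply path_cat with (s1 t0, y1 t0); now apply path_integral_rev.
  + apply path_cat with (s2 t, y2 t); [exact hU2|].
    apply path_cat with (s2 t0, y2 t0); now apply path_integral_rev.
Qed.

End Paths.

(** * The two roots together: separated equations and linear motion *)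

Theorem proposition2 (g2 g3 k : C) (a b : Rbar)
    (x1 x2 e1 e2 r gam3 w s1 s2 : R -> C)
    (hmotion : equations_of_motion g2 (time_interval a b) x1 x2 e1 e2 r gam3)
    (hinv : forall t : R, time_interval a b t ->
       invariant_relations g2 g3 k (x1 t) (x2 t) (e1 t) (e2 t) (r t) (gam3 t))
    (hsum : forall t : R, time_interval a b t -> x1 t + x2 t <> 0)
    (hA : forall t : R, time_interval a b t -> coefA (x1 t) (x2 t) <> 0)
    (hdisc : forall t : R, time_interval a b t -> discF g2 g3 (x1 t) (x2 t) <> 0)
    (hw : sqrt_branch (time_interval a b)
            (fun t => discF g2 g3 (x1 t) (x2 t)) w)
    (hs1 : forall t : R, time_interval a b t ->
       s1 t = rootF g2 g3 (x1 t) (x2 t) (- w t))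
    (hs2 : forall t : R, time_interval a b t ->
       s2 t = rootF g2 g3 (x1 t) (x2 t) (w t)) :
  exists y1 y2 : R -> C,
    sqrt_branch (time_interval a b) (fun t => Phi g2 g3 k (s1 t)) y1 /\
    sqrt_branch (time_interval a b) (fun t => Phi g2 g3 k (s2 t)) y2 /\
    separated_equations (Phi g2 g3 k) (time_interval a b) s1 s2 y1 y2 /\
    (genus_two g2 g3 k ->
     linear_on_jacobian (Phi g2 g3 k) (dPhi g2 g3 k) (time_interval a b)
       (fun t => (s1 t, y1 t)) (fun t => (s2 t, y2 t)) (RtoC 0, Ci)).

Proof.
pose (I := time_interval a b).
assert (oI : open I).
{ apply open_and; intros x; [apply open_Rbar_gt'|apply open_Rbar_lt']. }
(* One formula gives both ordinates; the sign of [w] distinguishes the roots and enters [v] as a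
   factor -1. *)
pose (y s t := yF g2 g3 (x1 t) (x2 t) (x1 t ^ 2 * r t + gam3 t)
                  (x2 t ^ 2 * r t + gam3 t) (s t)).
pose (v w t := Ci * coefA (x1 t) (x2 t) / w t).
assert (hw' : sqrt_branch I (fun t => discF g2 g3 (x1 t) (x2 t))
                (fun t => - w t)).
{ intros t It; destruct (hw t It) as [c e]; split.
  - now apply contC_opp.
  - rewrite <- e; ring. }
assert (w0 : forall t, I t -> w t <> 0).
{ intros t It h; apply (hdisc t It); rewrite <- (proj2 (hw t It)), h; ring. }
assert (f1 := separating_root _ _ _ _ _ _ _ _ _ _ _ _
  oI hmotion hinv hsum hA hdisc hw' hs1).
assert (f2 := separating_root _ _ _ _ _ _ _ _ _ _ _ _
  oI hmotion hinv hsum hA hdisc hw hs2).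
change (forall t, I t -> y s1 t ^ 2 = Phi g2 g3 k (s1 t) /\
  is_derivC s1 t (y s1 t * v (fun z => - w z) t) /\
  is_derivC (y s1) t (dPhi g2 g3 k (s1 t) * v (fun z => - w z) t / 2) /\
  contC (v (fun z => - w z)) t) in f1.
change (forall t, I t -> y s2 t ^ 2 = Phi g2 g3 k (s2 t) /\
  is_derivC s2 t (y s2 t * v w t) /\
  is_derivC (y s2) t (dPhi g2 g3 k (s2 t) * v w t / 2) /\
  contC (v w) t) in f2.
assert (c1 : forall t, I t -> v (fun z => - w z) t + v w t = 0).
{ intros t It; unfold v; field; now apply w0. }
assert (c2 : forall t, I t ->
  s1 t * v (fun z => - w z) t + s2 t * v w t = Ci).
(* Here [s2 - s1 = w / A], the inverse of [v w t] up to the factor [Ci]. *)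
{ intros t It; rewrite hs1, hs2 by exact It; unfold v, rootF.
  field; split; [now apply w0|now apply hA]. }
clearbody y v.
exists (y s1), (y s2); split; [|split; [|split]].
- intros t It; destruct (f1 t It) as (e & _ & d & _); split; [|exact e].
  exact (derivC_cont _ _ _ d).
- intros t It; destruct (f2 t It) as (e & _ & d & _); split; [|exact e].
  exact (derivC_cont _ _ _ d).
- intros t It; destruct (f1 t It) as (e1' & d1 & _);
  destruct (f2 t It) as (e2' & d2 & _).
  exists (y s1 t * v (fun z => - w z) t), (y s2 t * v w t).
  split; [exact d1|split; [exact d2|]].
  (* Away from the zeros of Phi the ordinates are nonzero, and dividing [s' = y v] by [y] reduces
     both equations to [c1] and [c2]. *)
  intros n1 n2.
  assert (m1 : y s1 t <> 0) by (intros h; apply n1; rewrite <- e1', h; ring).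
  assert (m2 : y s2 t <> 0) by (intros h; apply n2; rewrite <- e2', h; ring).
  split.
  + rewrite <- (c1 t It); field; auto.
  + rewrite <- (c2 t It); field; auto.
- intros _.
  apply (linear_of_constant_velocity _ _ I s1 (y s1) (v (fun z => - w z))
    s2 (y s2) (v w)); auto.
  intros p q t [p1 p2] [q1 q2] [h1 h2]; split.
  + refine (Rbar_lt_le_trans a (Rmin p q) t _ h1).
    unfold Rmin; destruct (Rle_dec p q); assumption.
  + refine (Rbar_le_lt_trans t (Rmax p q) b h2 _).
    unfold Rmax; destruct (Rle_dec p q); assumption.
Qed.
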